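(* Let $m,n\in\mathbb{N}$. For every $(a,b,c,d,\ell)\in J_{m,n}$, the subgroup $K_{a,b,c,d,\ell}$ of $\mathbb{Z}_m\times\mathbb{Z}_n$ satisfies $$(\mathbb{Z}_m\times \mathbb{Z}_n)/K_{a,b,c,d,\ell} \simeq \mathbb{Z}_{\gcd\left(\frac{m}{a},\frac{n}{c}\right)} \times \mathbb{Z}_{\operatorname{lcm}\left(\frac{m}{b},\frac{n}{d}\right)},$$ where $\gcd \left(\frac{m}{a},\frac{n}{c}\right) \mid \operatorname{lcm}\left(\frac{m}{b},\frac{n}{d}\right)$ (so this is the invariant factor decomposition of the quotient group).
   Context: $\mathbb{N}=\{1,2,\ldots\}$ and $\mathbb{Z}_n$ is the additive group of residue classes modulo $n$. For $m,n\in\mathbb{N}$ define $$J_{m,n}:=\left\{(a,b,c,d,\ell)\in \mathbb{N}^5: a\mid m,\ b\mid a,\ c\mid n,\ d\mid c,\ \frac{a}{b}=\frac{c}{d},\ \ell \le \frac{a}{b},\ \gcd\left(\ell,\frac{a}{b} \right)=1\right\},$$ and for $(a,b,c,d,\ell)\in J_{m,n}$ define the subset (which is a subgroup, of order $ad$) of $\mathbb{Z}_m\times\mathbb{Z}_n$ $$K_{a,b,c,d,\ell}:= \left\{\left(i\frac{m}{a},\ i\ell \frac{n}{c}+j\frac{n}{d}\right): 0\le i\le a-1,\ 0\le j\le d-1\right\},$$ where the coordinates are taken modulo $m$ and modulo $n$, respectively. It is known that $(a,b,c,d,\ell)\mapsto K_{a,b,c,d,\ell}$ is a bijection from $J_{m,n}$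 onto the set of all subgroups of $\mathbb{Z}_m\times\mathbb{Z}_n$. *)

(* Defs.v *)
From mathcomp Require Import all_boot all_fingroup all_algebra all_solvable.

Set Implicit Arguments.
Unset Strict Implicit.
Unset Printing Implicit Defensive.

(* The additive group Z/n for n >= 1.  Unlike 'Z_n, this is the trivial group *)
(* when n = 1.  It also denotes the trivial group when n = 0, so it is to be  *)
(* used for n > 0 only.                                                       *)
Notation Zmod n := 'I_n.-1.+1.

Definition in_J (m n a b c d l : nat) : bool :=
  [&& [&& 0 < a, 0 < b, 0 < c, 0 < d & 0 < l],
      a %| m, b %| a, c %| n, d %| c,
      a %/ b == c %/ d, l <= a %/ b & coprime l (a %/ b)].

Definition K (m n a b c d l : nat) : {set Zmod m * Zmod n} :=
  [set (inZp (i * (m %/ a)), inZp (i * l * (n %/ c) + j * (n %/ d)))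
     | i : 'I_a, j : 'I_d].

(* Main.v *)
Require Import Defs.
From mathcomp Require Import all_boot all_fingroup all_algebra all_solvable.
From mathcomp Require Import zify ring.

(** Put [M = m/a], [N = n/c], [e = a/b = c/d], [g = gcd(M,N)], [M = g M'],
    [N = g N'], and [L = lcm(m/b, n/d) = g e M' N'].  The quotient is
    [Z^2 / <(M, l N), (0, e N)>].  Choose [t] coprime to [N'] with
    [t l = -1] mod [e]; then the form [(x, y) |-> N' x + M' t y] has coprime
    coefficients and vanishes mod [L] on both generators.  Complete it to a
    unimodular matrix by a row [(al, be)]: since [g] divides [M] and [N], the
    resulting map [Z_m x Z_n -> Z_g x Z_L] is onto and kills [K], and
    [#|K| = a d = m n / (g L)] forces [K] to be its kernel. *)

(** Replacing [x] by [x %% m] alters [k * x] by a multiple of [k * m], hence of [D]. This makes a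
    linear form on residues independent of the representatives. *)
Lemma modn_lin2 D m n k k' x y : D %| k * m -> D %| k' * n ->
  k * (x %% m) + k' * (y %% n) = k * x + k' * y %[mod D].
Proof.
move=> /dvdnP[u Du] /dvdnP[v Dv].
rewrite [in RHS](divn_eq x m) [in RHS](divn_eq y n) !mulnDr.
rewrite [k * (_ * _)]mulnCA [k' * (_ * _)]mulnCA Du Dv addnACA !mulnA -mulnDl.
by rewrite modnMDl.
Qed.

(** A prime dividing [e] cannot divide a number congruent to [v], so only the part [k'] of [k] prime
    to [e] needs care; there the Chinese remainder theorem imposes the residue 1. *)
Lemma coprime_lift e k v : 0 < e -> 0 < k -> coprime v e ->
  exists t, [/\ 0 < t, t = v %[mod e] & coprime t k].
Proof.
move=> e0 k0 cve; set k' := k`_(\pi(e))^'.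
have cek' : coprime e k'.
    by apply: (@pnat_coprime \pi(e)); rewrite ?pnat_pi ?part_pnat.
have k'0 : 0 < k' by rewrite part_gt0.
(* The summand [e * k'] changes neither residue and ensures positivity. *)
exists (chinese e k' v 1 + e * k'); split; first by rewrite addn_gt0 muln_gt0 e0 k'0 orbT.
  by rewrite addnC [e * _]mulnC modnMDl chinese_modl.
set t := _ + _.
have te : coprime t e.
  by rewrite -coprime_modl /t addnC [e * _]mulnC modnMDl chinese_modl // coprime_modl.
have tk' : coprime t k'.
  by rewrite -coprime_modl /t addnC modnMDl chinese_modr // coprime_modl coprime1n.
rewrite -(partnC \pi(e) k0) coprimeMr tk' andbT.
have t0 : 0 < t by rewrite addn_gt0 muln_gt0 e0 k'0 orbT.
rewrite coprime_sym; apply: (@pnat_coprime \pi(e)); first exact: part_pnat.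
by rewrite -coprime_pi' // coprime_sym.
Qed.

Section LinearMap.

Variables (m n p q al be ga de : nat).
Hypothesis al_m : p.+1 %| al * m.+1.
Hypothesis be_n : p.+1 %| be * n.+1.
Hypothesis ga_m : q.+1 %| ga * m.+1.
Hypothesis de_n : q.+1 %| de * n.+1.

Definition linZp (u : 'I_m.+1 * 'I_n.+1) : 'I_p.+1 * 'I_q.+1 :=
  (inZp (al * u.1 + be * u.2), inZp (ga * u.1 + de * u.2)).

Lemma linZp_inZp x y :
  linZp (inZp x, inZp y) = (inZp (al * x + be * y), inZp (ga * x + de * y)).
Proof. by congr pair; apply: val_inj; rewrite /= modn_lin2. Qed.

Lemma linZpM : {morph linZp : u v / (u * v)%g}.
Proof.
move=> [x y] [x' y']; congr pair; apply: val_inj;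
  rewrite /= modn_lin2 // modnDm; congr modn; ring.
Qed.

Canonical linZp_morphism := @Morphism _ _ setT linZp (in2W linZpM).

Hypothesis pq : p.+1 %| q.+1.
Hypothesis det1 : al * de = be * ga + 1.

Lemma linZp_surj w : exists u, linZp u = w.
Proof.
case: w => r s.
(* This is the inverse matrix with rows [(de, -be)] and [(-ga, al)] applied to [(r, s)]; [q] stands
   for -1, modulo [q.+1] and so also modulo its divisor [p.+1]. *)
exists (inZp (de * r + be * q * s), inZp (ga * q * r + al * s)).
rewrite linZp_inZp; congr pair; apply: val_inj => /=.
  case/dvdnP: pq => k kq.
  have -> : al * (de * r + be * q * s) + be * (ga * q * r + al * s)
    = (be * ga * r + al * be * s) * k * p.+1 + r.
    by rewrite -[_ * k * _]mulnA -kq; nia.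
  by rewrite modnMDl modn_small.
have -> : ga * (de * r + be * q * s) + de * (ga * q * r + al * s)
    = (ga * de * r + be * ga * s) * q.+1 + s by nia.
by rewrite modnMDl modn_small.
Qed.

Lemma linZp_isog :
  ([set: 'I_m.+1 * 'I_n.+1] / 'ker linZp)%g \isog [set: 'I_p.+1 * 'I_q.+1].
Proof.
have <- : (linZp @* setT)%g = setT.
  apply/setP => w; rewrite inE; apply/morphimP.
  by case: (linZp_surj w) => u <-; exists u; rewrite ?inE.
exact: first_isog.
Qed.

End LinearMap.

(** The parametrization is injective: [i * (m %/ a) < m] recovers [i] from the first coordinate;
    cancelling the term in [i], [j * (n %/ d) < n] then recovers [j]. *)
Lemma card_K m n a b c d l : 0 < m -> 0 < n -> in_J m n a b c d l ->
  #|K m n a b c d l| = a * d.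
Proof.
move=> m0 n0 /and4P[/and5P[a0 b0 c0 d0 _]] am ba /and5P[cn dc _ _ _].
pose f (u : 'I_a * 'I_d) : Zmod m * Zmod n :=
  (inZp (u.1 * (m %/ a)), inZp (u.1 * l * (n %/ c) + u.2 * (n %/ d))).
have -> : K m n a b c d l = f @: setT.
  apply/setP => w; apply/imset2P/imsetP => [[i j _ _ ->]|[[i j] _ ->]].
    by exists (i, j).
  by exists i j.
have small k x (y : 'I_k) : 0 < x -> k %| x -> y * (x %/ k) < x.
  move=> x0 kx; have q0 : 0 < x %/ k by rewrite divn_gt0 ?(dvdn_leq x0 kx) ?(dvdn_gt0 x0 kx).
  by rewrite -[ltnRHS](divnK kx) mulnC ltn_pmul2l.
rewrite card_in_imset ?cardsT ?card_prod ?card_ord // => -[i j] [i' j'] _ _.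
case=> /eqP eqx /eqP eqy; move: eqx eqy; rewrite !prednK //.
have dn := dvdn_trans dc cn.
rewrite ![_ %% m]modn_small ?small // eqn_pmul2r ?divn_gt0 ?(dvdn_leq m0 am) //.
move=> /eqP/val_inj <-; rewrite eqn_modDl !modn_small ?small //.
rewrite eqn_pmul2r ?divn_gt0 ?(dvdn_leq n0 dn) //.
by move=> /eqP/val_inj <-.
Qed.

Theorem proposition2 (m n : nat) (hm : 0 < m) (hn : 0 < n)
    (a b c d l : nat) (hJ : in_J m n a b c d l) :
  [/\ group_set (K m n a b c d l),
      ([set: Zmod m * Zmod n] / K m n a b c d l)%g
        \isog [set: Zmod (gcdn (m %/ a) (n %/ c)) *
                    Zmod (lcmn (m %/ b) (n %/ d))]
    & gcdn (m %/ a) (n %/ c) %| lcmn (m %/ b) (n %/ d)].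
Proof.
have cardK := card_K m n a b c d l hm hn hJ.
case/and4P: hJ => /and5P[a0 b0 c0 d0 l0] am ba /and5P[cn dc /eqP ab_cd _ cle].
set M := m %/ a; set N := n %/ c; set e := a %/ b in ab_cd cle.
set g := gcdn M N; set L := lcmn _ _.
have mE : m = M * a by rewrite divnK.
have nE : n = N * c by rewrite divnK.
have aE : a = e * b by rewrite divnK.
have cE : c = e * d by rewrite ab_cd divnK.
have mb : m %/ b = M * e by rewrite mE aE mulnA mulnK.
have nd : n %/ d = N * e by rewrite nE cE mulnA mulnK.
have M0 : 0 < M by move: hm; rewrite mE muln_gt0 => /andP[].
have N0 : 0 < N by move: hn; rewrite nE muln_gt0 => /andP[].
have e0 : 0 < e by move: a0; rewrite aE muln_gt0 => /andP[].
have g0 : 0 < g by rewrite gcdn_gt0 M0.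
pose M' := M %/ g; pose N' := N %/ g.
have ME : M = M' * g by rewrite divnK // dvdn_gcdl.
have NE : N = N' * g by rewrite divnK // dvdn_gcdr.
have M'0 : 0 < M' by move: M0; rewrite ME muln_gt0 => /andP[].
have N'0 : 0 < N' by move: N0; rewrite NE muln_gt0 => /andP[].
have coMN : coprime M' N'.
  by rewrite /coprime -(eqn_pmul2r g0) muln_gcdl -ME -NE mul1n.
have LE : L = M' * N' * g * e.
  rewrite /L mb nd -muln_lcml ME NE -muln_lcml; congr (_ * _ * _).
  (* Both sides are multiplied by 1, read on the left as [gcdn M' N'], so that lcm times gcd gives
     the product. *)
  by apply/eqP; rewrite -(eqn_pmul2r (ltn0Sn 0)) -{1}(eqP coMN) muln_lcm_gcd muln1.
have gL : g %| L by rewrite LE dvdn_mulr // dvdn_mull.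
have L0 : 0 < L by rewrite LE !muln_gt0 M'0 N'0 g0.
have [t [t0 tl tN']] : exists t, [/\ 0 < t, e %| t * l + 1 & coprime t N'].
  (* Here [u * e = v * l + 1], so [v] is an inverse of [-l] modulo [e]; it is then lifted to a [t]
     coprime to [N']. *)
  have [u v uv _] := egcdnP l e0.
  rewrite gcdnC (eqP cle) in uv.
  have cve : coprime v e.
    rewrite coprime_sym; apply/coprimeP => //; exists (u, l).
    by rewrite /= uv mulnC addKn.
  have [t [t0 tv tN']] := coprime_lift e N' v e0 N'0 cve.
  exists t; split=> //; rewrite /dvdn -modnDml -modnMml tv modnMml modnDml.
  by rewrite -uv modnMl.
have cMtN : coprime N' (M' * t) by rewrite coprimeMr coprime_sym coMN coprime_sym.
have Mt0 : 0 < M' * t by rewrite muln_gt0 M'0.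
(* Bezout in the form [al * (M' * t) = be * N' + 1] is exactly the determinant condition for the
   second row [(N', M' * t)]. *)
have [al be det1 _] := egcdnP N' Mt0.
rewrite gcdnC (eqP cMtN) in det1.
have al_m : g.-1.+1 %| al * m.-1.+1
  by rewrite !prednK // mE ME;
     apply/dvdnP; exists (al * M' * a); ring.
have be_n : g.-1.+1 %| be * n.-1.+1
  by rewrite !prednK // nE NE;
     apply/dvdnP; exists (be * N' * c); ring.
have ga_m : L.-1.+1 %| N' * m.-1.+1
  by rewrite !prednK // mE ME LE aE;
     apply/dvdnP; exists b; ring.
have de_n : L.-1.+1 %| M' * t * n.-1.+1
  by rewrite !prednK // nE NE LE cE;
     apply/dvdnP; exists (t * d); ring.
have gL' : g.-1.+1 %| L.-1.+1 by rewrite !prednK.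
have iso := linZp_isog _ _ _ _ _ _ _ _ al_m be_n ga_m de_n gL' det1.
set phi := linZp_morphism _ _ _ _ _ _ _ _ al_m be_n ga_m de_n.
have card_ker : #|('ker phi)%g| = a * d.
  have := card_isog iso.
  rewrite card_quotient ?(normal_norm (ker_normal phi)) // => idx.
  have := Lagrange (subsetT ('ker phi)%g).
  rewrite idx !cardsT !card_prod !card_ord !prednK // => eq_card.
  apply/eqP; rewrite -(eqn_pmul2r (_ : 0 < g * L)) ?muln_gt0 ?g0 //.
  rewrite eq_card mE nE ME NE LE cE; apply/eqP; ring.
have KE : K m n a b c d l = ('ker phi)%g.
  apply/eqP; rewrite eqEcard cardK card_ker leqnn andbT.
  apply/subsetP => _ /imset2P[i j _ _ ->]; apply/kerP; rewrite ?inE //.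
  rewrite [LHS]linZp_inZp //; congr pair; apply: val_inj; rewrite /= !prednK //; apply/eqP.
    rewrite -/M -/N nd ME NE; apply/(@dvdnP g).
    by exists (al * i * M' + be * (i * l * N' + j * N' * e)); ring.
  case/dvdnP: tl => k tl; apply/(@dvdnP L); rewrite -/M -/N nd LE ME NE.
  (* With [t * l + 1 = k * e], the terms in [i] add up to [i * k * L], while those in [j] give
     [j * t * L]. *)
  exists (i * k + j * t).
  have -> : N' * (i * (M' * g)) + M' * t * (i * l * (N' * g) + j * (N' * g * e))
    = N' * M' * g * i * (t * l + 1) + M' * N' * g * t * j * e by ring.
  by rewrite tl; ring.
rewrite KE; split=> //; exact: groupP.
Qed.
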